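(* Let $m\ge 3$ be an integer with $m\neq 4,5$. Then one can assign to every cell $P$ of the regular hexagonal tessellation of the plane a set $A(P)$ of $(1,-1)$-sequences of length $2^m$ such that: (1) $\#A(P)=2^{m-2}$ for every cell $P$, and any two distinct sequences in $A(P)$ are orthogonal; (2) for any two adjacent cells $P,Q$, every sequence in $A(P)$ is orthogonal to every sequence in $A(Q)$; (3) for any two distinct sequences $\xi,\xi'$ belonging to $\bigcup_P A(P)$, one has $|\xi\cdot\xi'|\le 2^{\lfloor (m+2)/2\rfloor}$; (4) the re-use distance of the assignment is $D=4$.
   Context: The inner product of two $(1,-1)$-sequences $\xi=(\xi_1,\dots,\xi_N)$ and $\xi'=(\xi'_1,\dots,\xi'_N)$ is the integer $\xi\cdot\xi'=\sum_{i=1}^N\xi_i\xi'_i$; the sequences are orthogonal if $\xi\cdot\xi'=0$. Two distinct cells of the regular hexagonal tessellation are adjacent if they share an edge. The distance between two cells is the graph distance in the adjacency graph of the cells. The cells may be identified with $\mathbb{Z}^2$, where $P$ and $Q$ are adjacent if and only if $P-Q\in\{\pm(1,0),\pm(0,1),\pm(1,1)\}$. The re-use distance $D$ of an assignment $P\mapsto A(P)$ is the minimum distance between two distinct cells $P\ne Q$ with $A(P)\cap A(Q)\neq\emptyset$. *)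

(* Defs.v *)
From mathcomp Require Import all_boot all_order all_algebra.

Set Implicit Arguments.
Unset Strict Implicit.
Unset Printing Implicit Defensive.

Import Order.TTheory GRing.Theory Num.Theory.
Local Open Scope ring_scope.

Notation sign := (seq_sub [:: 1 : int; -1]).

Notation sign_seq N := {ffun 'I_N -> sign}.

Definition inner (N : nat) (x y : sign_seq N) : int :=
  \sum_(i < N) val (x i) * val (y i).

Definition orthogonal_seq (N : nat) (x y : sign_seq N) : Prop :=
  inner x y = 0.

(* Cells of the regular hexagonal tessellation, in coordinates for which the  *)
(* six neighbours of P are P + d with d in hex_dirs.                          *)
Notation cell := (int * int)%type.

Definition hex_dirs : seq cell :=
  [:: (1, 0); (-1, 0); (0, 1); (0, -1); (1, 1); (-1, -1)].

Definition hex_adj (P Q : cell) : bool := P - Q \in hex_dirs.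

(* hex_walk n P Q: there is a walk of length n from P to Q in the adjacency   *)
(* graph, see hex_walkP; the recursion makes it decidable, as needed by       *)
(* ex_minn in hex_dist.                                                       *)
Fixpoint hex_walk (n : nat) (P Q : cell) : bool :=
  if n is n'.+1 then has (fun d => hex_walk n' (P + d) Q) hex_dirs
  else P == Q.

Lemma hex_dirsN d : (- d \in hex_dirs) = (d \in hex_dirs).
Proof.
have sub e : e \in hex_dirs -> - e \in hex_dirs.
  by rewrite !inE => /or4P[|||/or3P[||]] /eqP->.
by apply/idP/idP => /sub //; rewrite opprK.
Qed.

Lemma hex_walkS n P Q :
  hex_walk n.+1 P Q = has (fun d => hex_walk n (P + d) Q) hex_dirs.
Proof. by []. Qed.

Lemma hex_walkP n P Q :
  reflect (exists p : seq cell, [/\ size p = n, path hex_adj P p & last P p = Q])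
          (hex_walk n P Q).
Proof.
elim: n P => [|n IHn] P.
  apply: (iffP eqP) => [<-|[p [/size0nil-> _ //]]].
  by exists [::].
rewrite hex_walkS; apply: (iffP hasP).
  case=> d d_dir /IHn[p [szp Pp lp]].
  exists (P + d :: p) => /=; rewrite szp lp Pp andbT; split=> //.
  by rewrite /hex_adj opprD addNKr hex_dirsN.
case=> -[|R p] [] //= [szp] /andP[adjPR pathp] lp; exists (R - P).
  by rewrite -hex_dirsN opprB.
by apply/IHn; exists p; rewrite addrC subrK.
Qed.

Lemma hex_connected (P Q : cell) : exists n, hex_walk n P Q.
Proof.
have cat n1 n2 P1 P2 P3 :
    hex_walk n1 P1 P2 -> hex_walk n2 P2 P3 -> hex_walk (n1 + n2) P1 P3.
  elim: n1 P1 => [|n1 IH] P1; first by move/eqP->.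
  rewrite addSn !hex_walkS; case/hasP=> d dd w1 w2.
  by apply/hasP; exists d => //; exact: (IH _ w1 w2).
have line n d R : d \in hex_dirs -> hex_walk n R (R + d *+ n).
  move=> dd; elim: n R => [|n IH] R; first by rewrite mulr0n addr0 /=.
  by rewrite hex_walkS; apply/hasP; exists d; rewrite // mulrS addrA.
have axis (k : int) d R : d \in hex_dirs -> hex_walk `|k| R (R + d *~ k).
  move=> dd; case: k => k; first exact: line.
  by rewrite NegzE mulrNz -mulNrz; apply: line; rewrite hex_dirsN.
pose a := Q.1 - P.1; pose b := Q.2 - P.2.
exists (`|a| + `|b|)%N; apply: cat (axis a (1, 0) P isT) _.
have -> : Q = P + (1, 0) *~ a + (0, 1) *~ b; last exact: axis.
have pairz (u v k : int) : (u, v) *~ k = (u * k, v * k).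
  have pairn (n : nat) : (u, v) *+ n = (u *+ n, v *+ n).
    by elim: n => // n IHn; rewrite !mulrS IHn.
  rewrite -[u * k]mulrzz -[v * k]mulrzz.
  by case: k => k; rewrite ?NegzE ?mulrNz -!pmulrn pairn.
rewrite !pairz !mul0r !mul1r [LHS]surjective_pairing; congr pair => /=.
  by rewrite addr0 addrC subrK.
by rewrite addr0 addrC subrK.
Qed.

Definition hex_dist (P Q : cell) : nat := ex_minn (hex_connected P Q).

Definition reuse_distance (T : finType) (A : cell -> {set T}) (D : nat) : Prop :=
  (exists P Q : cell, [/\ P <> Q, A P :&: A Q <> set0 & hex_dist P Q = D])
  /\ (forall P Q : cell, P <> Q -> A P :&: A Q <> set0 -> (D <= hex_dist P Q)%N).

(* Main.v *)
Require Import Defs.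
From mathcomp Require Import all_boot all_order all_algebra.
From mathcomp Require Import zify.

Set Implicit Arguments.
Unset Strict Implicit.
Unset Printing Implicit Defensive.

Import Order.TTheory GRing.Theory Num.Theory.
Local Open Scope ring_scope.

(* Write sequences as signs of Boolean functions on F_2^d x F_2^k x F_2^k with
   m = d + 2k and d = 2 or 3.  A cell gets an address (a, c) in F_2^2 x F_2^2
   depending only on its coordinates mod 4, and its sequences are
     base_(a,c),e (u) + y M_a z + t.z + s.y   for all s, t in F_2^k (and all e),
   where M_a ranges over {0, 1, M, 1 + M}, whose pairwise differences are
   invertible.  Correlations are products of a factor from the base and a
   factor from the quadratic form in (y, z); for a <> a' the latter is +-2^k
   (bent), and for a = a' it is 0 unless (s, t) = (s', t').  So everything
   reduces to the base: its correlations must vanish for adjacent cells and for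
   distinct words with a common a, and be at most 4 in absolute value
   otherwise.  For d = 2 (m even) base = c.u works; for d = 3 (m odd) one adds
   u3 (l_a (u1, u2) + e), with l_a the linear form killed by a, so that the
   quadratic part of the sum of two base words has radical spanned by a + a'.
   The matrix M exists exactly when k <> 1, which excludes m = 4 and m = 5. *)

(** * Cell addresses from coordinates modulo 4 *)

Notation bits := (bool * bool)%type.

Definition digits (x : int) : bits :=
  (odd `|(x %% 4)%Z|, (1 < `|(x %% 4)%Z|)%N).

Lemma digits_succ x :
  digits (x + 1) = (~~ (digits x).1, (digits x).1 (+) (digits x).2).
Proof.
rewrite /digits -modzDml.
have := modz_ge0 x (isT : 4 != 0 :> int).
have := ltz_pmod x (isT : 0 < 4 :> int).
by case: (x %% 4)%Z => // -[|[|[|[|]]]].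
Qed.

Lemma digits_inj x y : digits x = digits y -> (4 %| x - y)%Z.
Proof.
rewrite -eqz_mod_dvd /digits.
have := modz_ge0 x (isT : 4 != 0 :> int).
have := ltz_pmod x (isT : 0 < 4 :> int).
have := modz_ge0 y (isT : 4 != 0 :> int).
have := ltz_pmod y (isT : 0 < 4 :> int).
by case: (x %% 4)%Z => // -[|[|[|[|]]]] //;
   case: (y %% 4)%Z => // -[|[|[|[|]]]].
Qed.

(* Found by computer search; address_adj and address_inj are all that matters. *)
Definition encode (x y : bits) : bits * bits :=
  ((x.2, x.2 (+) y.2), (x.1 (+) y.1 (+) y.2, y.1)).

Definition address (P : cell) : bits * bits :=
  encode (digits P.1) (digits P.2).

Definition dotb (u v : bits) : bool := (u.1 && v.1) (+) (u.2 && v.2).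

Definition addb2 (u v : bits) : bits := (u.1 (+) v.1, u.2 (+) v.2).

Lemma dotbDl u v w : dotb (addb2 u v) w = dotb u w (+) dotb v w.
Proof. by case: u v w => [[] []] [[] []] [[] []]. Qed.

Lemma addb2_eq0 u v : (addb2 u v == (false, false)) = (u == v).
Proof. by case: u v => [[] []] [[] []]. Qed.

(** A condition that serves both bases: if [dotb] of a + a' and c + c' is 1, then c + c' differs
    from 0 and from the swap of a + a', because a vector of F_2^2 is [dotb]-orthogonal to its own
    swap. *)
Definition orthogonal_address (v w : bits * bits) : bool :=
  (v.1 == w.1) && (v.2 != w.2) || dotb (addb2 v.1 w.1) (addb2 v.2 w.2).

Lemma orthogonal_addressC v w :
  orthogonal_address v w = orthogonal_address w v.
Proof.
by case: v => [[[][]][[][]]]; case: w => [[[][]][[][]]].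
Qed.

Lemma address_adj P Q :
  hex_adj P Q -> orthogonal_address (address P) (address Q).
Proof.
(* By symmetry three of the six directions suffice; for each, all 16 pairs of residues are
   checked. *)
have step R (d : cell) : d \in [:: (1, 0); (0, 1); (1, 1)] ->
    orthogonal_address (address (R + d)) (address R).
  rewrite /address !inE => /or3P[] /eqP-> /=; rewrite ?addr0 ?digits_succ;
    by case: (digits R.1) => -[] []; case: (digits R.2) => -[] [].
rewrite /hex_adj => PQ; rewrite -[P](subrK Q) addrC.
have /orP[|PQ'] : (P - Q \in [:: (1, 0); (0, 1); (1, 1)]) ||
                  (- (P - Q) \in [:: (1, 0); (0, 1); (1, 1)]).
  by move: PQ; rewrite !inE => /or4P[||| /or3P[||]] /eqP->.
- exact: step.
- by rewrite orthogonal_addressC -{1}[Q](addrK (P - Q)) step.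
Qed.

Lemma address_inj P Q :
  address P = address Q -> (4 %| P.1 - Q.1)%Z /\ (4 %| P.2 - Q.2)%Z.
Proof.
move=> PQ; suff: digits P.1 = digits Q.1 /\ digits P.2 = digits Q.2.
  by case=> /digits_inj-> /digits_inj->.
by move: PQ; rewrite /address; do 4![case: (digits _) => -[] []].
Qed.

Lemma hex_walk_le n P Q :
  hex_walk n P Q -> `|P.1 - Q.1| <= n%:Z /\ `|P.2 - Q.2| <= n%:Z.
Proof.
elim: n P => [|n IHn] [x y]; first by move/eqP<-; rewrite !subrr.
rewrite hex_walkS => /hasP[[dx dy] d_dir /IHn[]].
have [] : `|dx| <= 1 /\ `|dy| <= 1.
  by move: d_dir; rewrite !inE => /or4P[||| /or3P[||]] /eqP[-> ->].
move=> /=; set u := Q.1; set v := Q.2; move: u v => u v; lia.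
Qed.

(** A shorter walk changes each coordinate by at most 3, and a multiple of 4 that small is 0. *)
Lemma hex_dist_ge4 P Q :
  P <> Q -> address P = address Q -> (4 <= hex_dist P Q)%N.
Proof.
move=> neqPQ /address_inj[d1 d2]; rewrite leqNgt; apply/negP => lt4.
case: neqPQ; move: lt4; rewrite /hex_dist; case: ex_minnP => n /hex_walk_le[].
case: P Q d1 d2 => [x y] [x' y'] /= /dvdzP[a xx'] /dvdzP[b yy'] *.
by congr pair; lia.
Qed.

Lemma hex_dist_origin40 : hex_dist (0, 0) (4, 0) = 4%N.
Proof.
apply/eqP; rewrite eqn_leq hex_dist_ge4 // andbT /hex_dist.
by case: ex_minnP => n _; apply; vm_compute.
Qed.

(** * Correlations of Boolean functions *)

Definition corr (I : finType) (f g : I -> bool) : int :=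
  \sum_x (-1) ^+ (f x (+) g x).

Lemma corr_self (I : finType) (f : I -> bool) : corr f f = #|I|%:R.
Proof.
by rewrite /corr (eq_bigr (fun=> 1)) ?sumr_const // => x _; rewrite addbb.
Qed.

Definition tensor (I J : finType) (f : I -> bool) (g : J -> bool) :
    I * J -> bool :=
  fun x => f x.1 (+) g x.2.

Lemma corr_tensor (I J : finType) (f f' : I -> bool) (g g' : J -> bool) :
  corr (tensor f g) (tensor f' g') = corr f f' * corr g g'.
Proof.
rewrite /corr big_distrlr /= pair_bigA; apply: eq_bigr => -[x y] _ /=.
by rewrite -signr_addb /tensor /= addbACA.
Qed.

Definition sign_of (b : bool) : sign :=
  if b then SeqSub (isT : -1 \in [:: 1 : int; -1])
  else SeqSub (isT : 1 \in [:: 1 : int; -1]).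

Definition to_seq (I : finType) (N : nat) (cardI : #|I| = N) (f : I -> bool) :
  sign_seq N := [ffun i => sign_of (f (enum_val (cast_ord (esym cardI) i)))].

Lemma inner_to_seq (I : finType) (N : nat) (cardI : #|I| = N)
    (f g : I -> bool) :
  inner (to_seq cardI f) (to_seq cardI g) = corr f g.
Proof.
subst N; rewrite /inner /corr.
rewrite [RHS](reindex _ (onW_bij _ (@enum_val_bij I))) /=.
apply: eq_bigr => i _.
by rewrite !ffunE cast_ord_id; case: f => /=; case: g.
Qed.

(** * Correlations of quadratic functions over F_2 *)

Lemma oppF2 (a : 'F_2) : - a = a.
Proof. by case: a => -[|[|]] // ?; apply: val_inj. Qed.

Section BentFamily.

Variable k : nat.
Implicit Types (x y s t : 'rV['F_2]_k) (A : 'M['F_2]_k).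

Definition chi (a : 'F_2) : int := (-1) ^+ (a != 0).

Lemma chiD a b : chi (a + b) = chi a * chi b.
Proof.
by rewrite /chi -signr_addb; case: a => -[|[|]] // ?; case: b => -[|[|]].
Qed.

Definition scalar (s t : 'rV['F_2]_k) : 'F_2 := (s *m t^T) 0 0.

Lemma scalarDl s t y : scalar (s + t) y = scalar s y + scalar t y.
Proof. by rewrite /scalar mulmxDl mxE. Qed.

Lemma scalarNl s y : scalar (- s) y = - scalar s y.
Proof. by rewrite /scalar mulNmx mxE. Qed.

Lemma scalarDr s x y : scalar s (x + y) = scalar s x + scalar s y.
Proof. by rewrite /scalar linearD mulmxDr mxE. Qed.

Lemma sum_chi s :
  \sum_y chi (scalar s y) = if s == 0 then 2 ^+ k else 0.
Proof.
have [->|/rV0Pn[i si]] := eqVneq s 0.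
  rewrite (eq_bigr (fun=> 1)) => [|y _]; last by rewrite /scalar mul0mx mxE.
  by rewrite sumr_const card_mx mul1n card_Fp // natrX.
have si1 : chi (scalar s (delta_mx 0 i)) = -1.
  by rewrite /scalar trmx_delta -colE mxE /chi si.
(* Translation by a basis vector on which [s] is nonzero flips every sign. *)
set S := \sum_y _; suff: S = - S by lia.
rewrite {1}/S (reindex_inj (addrI (delta_mx 0 i))) /= -sumrN.
by apply: eq_bigr => y _; rewrite scalarDr chiD si1 mulN1r.
Qed.

Definition quadratic A (st : 'rV['F_2]_k * 'rV['F_2]_k) :
    'rV['F_2]_k * 'rV['F_2]_k -> bool :=
  fun yz => scalar (yz.1 *m A + st.2) yz.2 + scalar st.1 yz.1 != 0.

(** Summing over z first gives a factor 2^k when y (A - B) = t' - t and 0 for every other y. *)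
Lemma corr_quadratic A B s t s' t' :
  corr (quadratic A (s, t)) (quadratic B (s', t')) =
  2 ^+ k * \sum_(y | y *m (A - B) == t' - t) chi (scalar (s - s') y).
Proof.
rewrite /corr -(pair_bigA _ (fun y z =>
  (-1) ^+ (quadratic A (s, t) (y, z) (+) quadratic B (s', t') (y, z)))) /=.
rewrite mulr_sumr [RHS]big_mkcond; apply: eq_bigr => y _ /=.
rewrite (eq_bigr (fun z => chi (scalar (y *m (A - B) - (t' - t)) z) *
                           chi (scalar (s - s') y))) => [|z _].
  by rewrite -mulr_suml sum_chi subr_eq0; case: eqP; rewrite ?mul0r.
rewrite signr_addb -!/(chi _) -!chiD; congr chi.
rewrite /= opprB mulmxBr !scalarDl !scalarNl !oppF2.
by rewrite [LHS]addrACA; congr (_ + _); rewrite addrACA.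
Qed.

Lemma corr_quadratic_same A u v :
  u != v -> corr (quadratic A u) (quadratic A v) = 0.
Proof.
case: u v => [s t] [s' t']; rewrite xpair_eqE negb_and corr_quadratic subrr.
rewrite (eq_bigl (fun=> t == t')) => [|y]; last first.
  by rewrite mulmx0 eq_sym subr_eq0 eq_sym.
case: (eqVneq t t') => /= _; last by rewrite big_pred0_eq mulr0.
by rewrite orbF sum_chi subr_eq0 => /negPf->; rewrite mulr0.
Qed.

Lemma corr_quadratic_unit A B u v :
  A - B \in unitmx -> `|corr (quadratic A u) (quadratic B v)| = 2 ^+ k.
Proof.
case: u v => [s t] [s' t'] unitAB; rewrite corr_quadratic.
rewrite (big_pred1 ((t' - t) *m invmx (A - B))) => [|y /=].
  by rewrite normrM normr_sign mulr1 normrX.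
by apply/eqP/eqP => [<-|->]; rewrite ?mulmxK ?mulmxKV.
Qed.

End BentFamily.

(** * Four matrices with invertible differences *)

Definition pencil (F : fieldType) k (M : 'M[F]_k) (a : bits) : 'M[F]_k :=
  a.1%:R%:M + a.2%:R *: M.

Lemma pencil_unit (F : fieldType) k (M : 'M[F]_k) a :
  M \in unitmx -> M + 1%:M \in unitmx -> a != (false, false) ->
  pencil M a \in unitmx.
Proof.
move=> unitM unitM1; case: a => [[] []] //= _; rewrite /pencil.
- by rewrite scale1r addrC.
- by rewrite scale0r addr0 unitmx1.
- by rewrite scale1r raddf0 add0r.
Qed.

Lemma pencil_sub k (M : 'M['F_2]_k) a b :
  pencil M a - pencil M b = pencil M (addb2 a b).
Proof.
have subF2 (c d : bool) : c%:R - d%:R = (c (+) d)%:R :> 'F_2.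
  by case: c d => [] []; apply: val_inj.
by rewrite /pencil opprD addrACA -raddfB -scalerBl !subF2.
Qed.

(** For k = 0 the empty matrix works. For k >= 2 the companion matrix of X^k + X + 1 works: this
    polynomial is 1 at both 0 and 1, so the matrix has no eigenvalue in F_2. *)
Lemma exists_unit_shift k : k != 1%N ->
  exists2 M : 'M['F_2]_k, M \in unitmx & M + 1%:M \in unitmx.
Proof.
case: k => [_|[//|k] _].
  by exists 0; rewrite unitmxE det_mx00 unitr1.
pose p : {poly 'F_2} := 'X^(k.+2) + ('X + 1%:P).
have small : (size ('X + 1%:P : {poly 'F_2})%R <
              size ('X^(k.+2) : {poly 'F_2})%R)%N.
  by rewrite size_XaddC size_polyXn.
have sz : (size p).-1 = k.+2 by rewrite size_polyDl // size_polyXn.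
have mon : p \is monic.
  by rewrite monicE lead_coefDl // lead_coefXn.
have unitC (a : 'F_2) : p.[a] != 0 -> companionmx p - a%:M \in unitmx.
  move=> pa; rewrite -row_free_unit -kermx_eq0 -[_ == 0]negbK.
  by rewrite -/(eigenvalue _ a) eigenvalue_root_char companionmxK.
rewrite -sz; exists (companionmx p); last first.
  have oppI n : - 1%:M = 1%:M :> 'M['F_2]_n.
    by rewrite -(raddfN (@scalar_mx _ n)) /= oppF2.
  by rewrite -oppI unitC // !hornerE expr1n.
by rewrite -[companionmx p]subr0 -(scale0r 1%:M) scalemx1 unitC //
           !hornerE expr0n.
Qed.

(** * From a suitable base to the assignment *)

Lemma hexagonal_assignment (m k : nat) (U E : finType) (M : 'M['F_2]_k)
    (base : bits * bits -> E -> U -> bool) :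
    M \in unitmx -> M + 1%:M \in unitmx ->
    #|U| = (4 * #|E|)%N -> (#|U| * (2 ^ k * 2 ^ k))%N = (2 ^ m)%N ->
    (k + 2 < m)%N ->
    (forall v w e f, orthogonal_address v w ->
       corr (base v e) (base w f) = 0) ->
    (forall v w e f, v.1 = w.1 -> (v, e) != (w, f) ->
       corr (base v e) (base w f) = 0) ->
    (forall v w e f, v.1 != w.1 -> `|corr (base v e) (base w f)| <= 4) ->
  exists A : cell -> {set sign_seq (2 ^ m)},
    [/\ forall P : cell,
          #|A P| = (2 ^ (m - 2))%N
          /\ (forall x y, x \in A P -> y \in A P -> x <> y ->
                orthogonal_seq x y),
        forall P Q : cell, hex_adj P Q ->
          forall x y, x \in A P -> y \in A Q -> orthogonal_seq x y,
        forall x y, (exists P : cell, x \in A P) ->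
          (exists Q : cell, y \in A Q) -> x <> y ->
          `|inner x y| <= 2 ^+ (k + 2)
      & reuse_distance A 4].
Proof.
move=> unitM unitM1 cardU cardN ltkm orth_adj orth_same bound.
pose W := ('rV['F_2]_k * 'rV['F_2]_k)%type.
have cardW : #|{: W}| = (2 ^ k * 2 ^ k)%N.
  by rewrite card_prod card_mx mul1n card_Fp.
have cardI : #|{: U * W}| = (2 ^ m)%N by rewrite card_prod cardW.
pose word v (i : E * W) :=
  to_seq cardI (tensor (base v i.1) (quadratic (pencil M v.1) i.2)).
have inner_word v w i j : inner (word v i) (word w j) =
    corr (base v i.1) (base w j.1) *
    corr (quadratic (pencil M v.1) i.2) (quadratic (pencil M w.1) j.2).
  by rewrite inner_to_seq corr_tensor.
have word_same v w i j : v.1 = w.1 -> (v, i) != (w, j) ->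
    inner (word v i) (word w j) = 0.
  case: i j => [e s] [f t] vw neq; rewrite inner_word /=.
  have [eq_ve|/orth_same->//] := eqVneq (v, e) (w, f); last by rewrite mul0r.
  rewrite vw corr_quadratic_same ?mulr0 //; apply: contraNneq neq => ->.
  by case: eq_ve => -> ->.
have word_bound v w i j : (v, i) != (w, j) ->
    `|inner (word v i) (word w j)| <= 2 ^+ (k + 2).
  move=> neq; have [vw|neq1] := eqVneq v.1 w.1.
    by rewrite word_same // normr0 exprn_ge0.
  rewrite inner_word normrM corr_quadratic_unit; last first.
    by rewrite pencil_sub pencil_unit ?addb2_eq0.
  by rewrite addnC exprD ler_wpM2r ?exprn_ge0 ?bound.
(* If two labels shared a word, its self-correlation 2^m would satisfy the bound 2^(k+2), which is
   less than 2^m. *)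
have word_inj v w i j : word v i = word w j -> (v, i) = (w, j).
  move=> eqw; apply/eqP; apply: contraLR ltkm => /word_bound.
  rewrite -eqw inner_to_seq corr_self cardI natrX -leqNgt.
  by rewrite ger0_norm ?exprn_ge0 // ler_eXn2l.
exists (fun P => [set word (address P) i | i : E * W]); split.
- move=> P; split.
    rewrite card_imset => [|i j /word_inj/(congr1 snd)//].
    have m2 : (2 <= m)%N by lia.
    apply/eqP; rewrite card_prod cardW -(@eqn_pmul2l 4) // mulnA -cardU cardN.
    by rewrite -(expnD 2 2) subnKC.
  move=> _ _ /imsetP[i _ ->] /imsetP[j _ ->] neq.
  apply: word_same => //.
  by apply: contra_notN neq => /eqP/(congr1 snd)/= ->.
- move=> P Q adjPQ _ _ /imsetP[i _ ->] /imsetP[j _ ->].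
  by rewrite /orthogonal_seq inner_word orth_adj ?mul0r ?address_adj.
- move=> _ _ [P /imsetP[i _ ->]] [Q /imsetP[j _ ->]] neq.
  apply: word_bound; apply: contra_notN neq => /eqP.
  by move/(congr1 (fun vi => word vi.1 vi.2)).
split=> [|P Q neqPQ /eqP/set0Pn[x]]; last first.
  rewrite inE => /andP[/imsetP[i _ ->] /imsetP[j _ /word_inj PQ]].
  by apply: hex_dist_ge4 => //; exact: (congr1 fst PQ).
exists (0, 0), (4, 0); split; [by []| |exact: hex_dist_origin40].
rewrite (_ : address (4, 0) = address (0, 0)) // setIid.
apply/eqP; rewrite -card_gt0 card_imset => [|i j /word_inj/(congr1 snd)//].
rewrite card_prod cardW muln_gt0 muln_gt0 expn_gt0 andbT /=.
(* An empty [E] would make [U] empty, yet 2^m is positive. *)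
rewrite lt0n; apply: contra_eq_neq cardN => E0.
by rewrite cardU E0 muln0 eq_sym -lt0n expn_gt0.
Qed.

(** * The bases for even and for odd m *)

Definition linear_base (v : bits * bits) (e : unit)
  (u : bits) : bool := dotb v.2 u.

Lemma linear_base_orthogonal v w e f :
  v.2 != w.2 -> corr (linear_base v e) (linear_base w f) = 0.
Proof.
rewrite /corr -(pair_bigA _ (fun x y =>
  (-1) ^+ (linear_base v e (x, y) (+) linear_base w f (x, y)))) /= !big_bool /=.
by case: v w => [? [[] []]] [? [[] []]].
Qed.

(** [dotb (swap a)] is the alternating form with a, hence a linear form that kills a. *)
Definition swap (u : bits) : bits := (u.2, u.1).

Definition quadratic_base (v : bits * bits) (e : bool)
    (u : bits * bool) : bool :=
  u.2 && (dotb (swap v.1) u.1 (+) e) (+) dotb v.2 u.1.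

(** The sum of two base words has again this shape, with parameters added. Its exponent is linear in
    (u1, u2) once u3 is fixed; u3 = 0 yields the first indicator and u3 = 1 the second. *)
Lemma corr_quadratic_base v w e f :
  corr (quadratic_base v e) (quadratic_base w f) =
  4 * ((v.2 == w.2)%:R +
       (-1) ^+ (e (+) f) * (addb2 v.2 w.2 == swap (addb2 v.1 w.1))%:R).
Proof.
have xorE u : quadratic_base v e u (+) quadratic_base w f u =
    quadratic_base (addb2 v.1 w.1, addb2 v.2 w.2) (e (+) f) u.
  have swapD : swap (addb2 v.1 w.1) = addb2 (swap v.1) (swap w.1) by [].
  rewrite /quadratic_base swapD !dotbDl.
  move: (dotb _ _) (dotb _ _) (dotb _ _) (dotb _ _) u.2 e f.
  by do 7!case.
have -> : (v.2 == w.2) = (addb2 v.2 w.2 == (false, false)).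
  by rewrite addb2_eq0.
rewrite /corr; under eq_bigr do rewrite xorE.
move: (addb2 v.1 w.1) (addb2 v.2 w.2) (e (+) f) => a c g.
rewrite -(pair_bigA _ (fun xy z => (-1) ^+ quadratic_base (a, c) g (xy, z))).
rewrite -(pair_bigA _ (fun x y =>
  \sum_z (-1) ^+ quadratic_base (a, c) g ((x, y), z))).
by rewrite !big_bool /=; case: a c g => [[] []] [[] []] [].
Qed.

Theorem mainTheorem1 (m : nat) (hm3 : (3 <= m)%N) (hm4 : m <> 4%N)
    (hm5 : m <> 5%N) :
  exists A : cell -> {set sign_seq (2 ^ m)},
    [/\ forall P : cell,
          #|A P| = (2 ^ (m - 2))%N
          /\ (forall x y, x \in A P -> y \in A P -> x <> y ->
                orthogonal_seq x y),
        forall P Q : cell, hex_adj P Q ->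
          forall x y, x \in A P -> y \in A Q -> orthogonal_seq x y,
        forall x y, (exists P : cell, x \in A P) ->
          (exists Q : cell, y \in A Q) -> x <> y ->
          `|inner x y| <= 2 ^+ ((m + 2) %/ 2)
      & reuse_distance A 4].
Proof.
(* So m = 2k + 2 or 2k + 3, and k = 1 exactly for m = 4 and 5. *)
pose k := ((m + 2) %/ 2 - 2)%N.
have -> : ((m + 2) %/ 2)%N = (k + 2)%N by lia.
have [|M unitM unitM1] := @exists_unit_shift k; first by apply/eqP; lia.
have card4 : #|{: bits}| = 4%N by rewrite card_prod card_bool.
case: (boolP (odd m)) => odd_m.
  apply: (hexagonal_assignment (base := quadratic_base) unitM unitM1).
  - by rewrite !card_prod card_bool.
  - rewrite !card_prod card_bool -!expnD -(expnD 2 3); congr expn; lia.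
  - lia.
  - move=> v w e f vw; rewrite corr_quadratic_base.
    by move: vw; case: v w => [[[][]][[][]]] [[[][]][[][]]]; rewrite //= mulr0.
  (* With equal a, both indicators vanish if c and d differ; otherwise e and f differ and the two
     terms cancel. *)
  - move=> [a c] [b d] e f /= <-; rewrite xpair_eqE xpair_eqE eqxx /=.
    rewrite corr_quadratic_base /= => neq.
    case: a c d e f neq => [[] []] [[] []] [[] []] [] []; by rewrite //= mulr0.
  (* Here the swap of a + a' is nonzero, so at most one indicator is 1. *)
  move=> v w e f neq; rewrite corr_quadratic_base.
  by move: neq; case: v w e f => [[[][]][[][]]] [[[][]][[][]]] [] [].
apply: (hexagonal_assignment (base := linear_base) unitM unitM1).
- by rewrite card4 card_unit.
- rewrite card4 -!expnD -(expnD 2 2); congr expn; lia.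
- lia.
- move=> v w e f vw; apply: linear_base_orthogonal.
  by move: vw; case: v w => [[[][]][[][]]] [[[][]][[][]]].
- move=> [a c] [b d] [] [] /= <- neq; apply: linear_base_orthogonal.
  by apply: contraNneq neq => /= ->.
(* The trivial bound suffices: the sum has four terms of absolute value 1. *)
move=> v w e f _; rewrite /corr.
rewrite (le_trans (ler_norm_sum _ _ _)) // (eq_bigr (fun=> 1)) => [|u _].
  by rewrite sumr_const card4.
by rewrite normr_sign.
Qed.
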